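(* There are constants $\epsilon,\gamma>0$ such that for all $n$ and all $k\le\epsilon n$: every classical (randomized) communication protocol with communication at most $\epsilon n$ in which Alice holds $x^{(1)},\dots,x^{(k)}\in\{0,1\}^n$, Bob holds $y^{(1)},\dots,y^{(k)}\in\{0,1\}^n$, and which outputs claimed values of $DISJ(x^{(1)},y^{(1)}),\dots,DISJ(x^{(k)},y^{(k)})$, has, on some input, probability at most $2^{-\gamma k}$ that all $k$ outputs are simultaneously correct.
   Context: $DISJ:\{0,1\}^n\times\{0,1\}^n\to\{0,1\}$, $DISJ(x,y)=1$ iff there is no $i$ with $x_i=y_i=1$ (the sets represented by $x$ and $y$ are disjoint). *)

(* Defs.v *)
From HB Require Import structures.
From mathcomp Require Import all_boot all_order all_algebra.
From mathcomp Require Import reals Rstruct Rstruct_topology exp.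
Set Implicit Arguments. Unset Strict Implicit. Unset Printing Implicit Defensive.
Import Order.TTheory GRing.Theory Num.Theory.

Definition DISJ (n : nat) (x y : 'I_n -> bool) : bool :=
  [forall i, ~~ (x i && y i)].

(* Deterministic two-party protocol tree: Alice holds a : A, Bob holds b : B.
   At an internal node the owner sends one bit computed from its own input
   (and, implicitly, the transcript so far = position in the tree);
   leaves carry the (public) output. *)
Inductive proto (A B O : Type) : Type :=
| Leaf of O
| ANode of (A -> bool) & proto A B O & proto A B O  (* Alice speaks; false->left *)
| BNode of (B -> bool) & proto A B O & proto A B O.

Arguments Leaf {A B O}.
Arguments ANode {A B O}.
Arguments BNode {A B O}.

Fixpoint run (A B O : Type) (p : proto A B O) (a : A) (b : B) : O :=
  match p with
  | Leaf o => o
  | ANode f l r => if f a then run r a b else run l a b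
  | BNode g l r => if g b then run r a b else run l a b
  end.

Fixpoint cost (A B O : Type) (p : proto A B O) : nat :=
  match p with
  | Leaf _ => 0
  | ANode _ l r => (maxn (cost l) (cost r)).+1
  | BNode _ l r => (maxn (cost l) (cost r)).+1
  end.

Definition kinput (k n : nat) := 'I_k -> 'I_n -> bool.
Definition koutput (k : nat) := 'I_k -> bool.

Definition all_correct (k n : nat) (x y : kinput k n) (o : koutput k) : bool :=
  [forall i, o i == DISJ (x i) (y i)].

(* Main.v *)
Require Import Defs.
From HB Require Import structures.
From mathcomp Require Import all_boot all_order all_algebra.
From mathcomp Require Import ring lra zify.
From mathcomp Require Import boolp reals Rstruct Rstruct_topology sequences exp.
Set Implicit Arguments. Unset Strict Implicit. Unset Printing Implicit Defensive.
Import Order.TTheory GRing.Theory Num.Theory.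
Local Open Scope ring_scope.

(* Razborov's corruption argument gives, for a single instance, probability
   distributions u1 on disjoint and u0 on intersecting pairs such that
   u1(R)/128 <= u0(R) + kappa^(n/128) for every rectangle R, where kappa < 1.
   Draw each of the k instances from (u0 + u1)/2.  Tensorising, a rectangle in
   the k-fold input space has mixture measure at least (1 + 1/128)^|o| times its
   mass on the inputs with answer vector o, up to an exponentially small error,
   |o| being the number of ones of o.  Summing over the at most 2^(eps n) leaves
   of a protocol bounds the success probability weighted by (1 + 1/128)^|o|,
   and AM-GM against the binomial distribution of |o| removes the weight. *)

Definition nonneg_weight (R : realFieldType) (X : finType) (w : X -> X -> R) :=
  forall x y, 0 <= w x y.
Definition prob_weight (R : realFieldType) (X : finType) (w : X -> X -> R) :=
  nonneg_weight w /\ \sum_x \sum_y w x y = 1.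

(** * Razborov's corruption bound *)

Section Sections.
Variables (R : realFieldType) (I : finType).
Implicit Types (A B : {set {set I}}) (C S T x y : {set I}) (i : I).

(** For one player's side [A] of a rectangle and the region [C] that a random split leaves to that
    player: [sec A C] divided by [2 ^ #|C|] is the probability that a uniform subset of [C] lies in
    [A]. *)
Definition sec A C : nat := #|[set x in A | x \subset C]|.
Definition secin A C i : nat := #|[set x in A | (x \subset C) && (i \in x)]|.

Lemma sec_split A C i : sec A C = (sec A (C :\ i) + secin A C i)%N.
Proof.
rewrite /sec /secin -(cardsID [set x : {set I} | i \in x]) addnC; congr (_ + _)%N;
  apply: eq_card => x; rewrite !inE ?subsetD1.
  by rewrite andbC andbA.
by rewrite andbA.
Qed.

Lemma sec_le A C : (sec A C <= 2 ^ #|C|)%N.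
Proof.
rewrite -card_powerset subset_leq_card //; apply/subsetP => x.
by rewrite !inE => /andP[].
Qed.

Lemma sec_setT C : sec setT C = (2 ^ #|C|)%N.
Proof. by rewrite -card_powerset; apply: eq_card => x; rewrite !inE. Qed.

Lemma secin_setT C i : i \in C -> secin setT C i = (2 ^ #|C :\ i|)%N.
Proof.
move=> iC; have := sec_split setT C i.
rewrite !sec_setT (cardsD1 i C) iC expnS mul2n -addnn.
by move/addnI.
Qed.

(** When [i] is not bad, requiring or forbidding [i] costs at most a factor 8, so disjoint inputs
    can be traded for inputs that share [i]. *)
Definition bad A C i : bool :=
  (8 * sec A (C :\ i) < sec A C)%N || (8 * secin A C i < sec A C)%N.

Definition kappa : R := 337 / 384.

Lemma kappa_gt0 : 0 < kappa. Proof. rewrite /kappa; lra. Qed.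
Lemma kappa_lt1 : kappa < 1. Proof. rewrite /kappa; lra. Qed.

(** A uniform subset of [C] has independent memberships, so the generating function of the number of
    agreements with [t] on [S] factorises: a coordinate of [S] gives [1 + l], one of [C :\: S] gives
    2. *)
Lemma sum_subset_prod C S (t : I -> bool) (l : R) : S \subset C ->
  \sum_(x : {set I} | x \subset C)
     \prod_(i in S) (if (i \in x) == t i then l else 1)
  = 2 ^+ #|C| * ((1 + l) / 2) ^+ #|S|.
Proof.
move=> SC.
pose g i b : R := if i \in S then (if b == t i then l else 1) else 1.
have -> : \sum_(x : {set I} | x \subset C)
     \prod_(i in S) (if (i \in x) == t i then l else 1) =
   \sum_(x : {set I}) \prod_i
      (if i \in x then (if i \in C then g i true else 0) else g i false).
  rewrite big_mkcond /=; apply: eq_bigr => x _.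
  case: ifP => [xC|/negbT/subsetPn[i ix iC]].
    rewrite big_mkcond /=; apply: eq_bigr => i _; rewrite /g.
    by have := subsetP xC i; case: (i \in x) => // ->.
  by rewrite (bigD1 i) //= ix (negbTE iC) mul0r.
rewrite -(bigA_distr _ _ (fun i => if i \in C then g i true else 0)
                         (fun i => g i false)) /=.
rewrite (bigID (mem C)) /= [X in _ * X]big1; last first.
  move=> i iC; rewrite (negbTE iC) add0r /g.
  by have := subsetP SC i; case: (i \in S) => // /(_ isT) iC'; rewrite iC' in iC.
rewrite mulr1 (bigID (mem S)) /=.
rewrite (eq_bigl (mem S)); last first.
  by move=> i /=; have := subsetP SC i; case: (i \in S) => [->|]; rewrite ?andbF.
rewrite (eq_bigr (fun=> 1 + l)); last first.
  move=> i iS; have {}iS : i \in S by []; rewrite (subsetP SC i iS) /g iS.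
  by case: (t i) => //=; rewrite addrC.
rewrite [X in _ * X](eq_bigl (mem (C :\: S))); last by move=> i /=; rewrite !inE andbC.
rewrite [X in _ * X](eq_bigr (fun=> 2)); last first.
  by move=> i; rewrite !inE /g => /andP[/negbTE -> ->].
rewrite !prodr_const expr_div_n cardsD (setIidPr SC).
have le : (#|S| <= #|C|)%N by apply: subset_leq_card.
rewrite -{2}(subnK le) exprD.
have h2 : (2 : R) ^+ #|S| != 0 by rewrite expf_neq0 // pnatr_eq0.
by field.
Qed.

(* A Chernoff bound: if every coordinate of S takes its rare value with
   frequency at most 1/8, then at least half of the members of the family take
   at most |S|/4 rare values; l = (3/4)^4 satisfies (1 + l)/2 < 3/4,
   and kappa is the ratio of these two numbers. *)
Lemma sec_le_bad A C :
  (sec A C)%:R <= 2 * 2 ^+ #|C| * kappa ^+ #|[set i in C | bad A C i]| :> R.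
Proof.
set S := [set i in C | _].
have SC : S \subset C by apply/subsetP => i; rewrite inE => /andP[].
(* [t i] is the rare membership value at [i]. *)
pose t i := (8 * secin A C i < sec A C)%N.
pose F := [set x in A | x \subset C].
have aE : sec A C = #|F| by [].
pose h x := #|[set i in S | (i \in x) == t i]|.
(* Double counting: each coordinate of [S] takes its rare value in at most an eighth of the
   section. *)
have h_sum : (8 * \sum_(x in F) h x <= #|S| * #|F|)%N.
  have -> : (\sum_(x in F) h x = \sum_(i in S) #|[set x in F | (i \in x) == t i]|)%N.
    under eq_bigr do rewrite /h -sum1dep_card.
    under [RHS]eq_bigr do rewrite -sum1dep_card.
    rewrite (exchange_big_dep (mem S)) /=; last by move=> x i _ /andP[].
    by apply: eq_bigr => i iS; apply: eq_bigl => x; rewrite iS.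
  rewrite big_distrr /= -sum_nat_const; apply: leq_sum => i.
  rewrite inE => /andP[iC]; rewrite /bad.
  case: (boolP (t i)) => [ti _|nti].
    rewrite /t in ti; apply: ltnW; apply: leq_trans ti.
    rewrite ltnS leq_mul2l /=; apply: eq_leq; apply: eq_card => x.
    by rewrite !inE eqb_id andbA.
  rewrite -/(t i) (negbTE nti) orbF => /ltnW; apply: leq_trans.
  rewrite leq_mul2l /=; apply: eq_leq; apply: eq_card => x.
  by rewrite !inE subsetD1 andbA eqbF_neg.
pose F' := [set x in F | (4 * h x <= #|S|)%N].
have F'F : F' \subset F by apply/subsetP => x; rewrite inE => /andP[].
(* Markov's inequality for [h], whose mean is at most [#|S| / 8]. *)
have half : (#|F| <= 2 * #|F'|)%N.
  case: (posnP #|S|) => [S0|Spos].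
    have -> : F' = F.
      apply/setP => x; rewrite inE; case: (x \in F) => //=.
      rewrite S0 leqn0 muln_eq0 /= -leqn0 -S0 subset_leq_card //.
      by apply/subsetP => i; rewrite inE => /andP[].
    by rewrite leq_pmull.
  have : (#|F :\: F'| * #|S|.+1 <= 4 * \sum_(x in F) h x)%N.
    rewrite big_distrr /= -sum_nat_const.
    rewrite [X in (_ <= X)%N](bigID (mem F')) /= addnC.
    apply: leq_trans (leq_addr _ _).
    rewrite [X in (_ <= X)%N](eq_bigl (mem (F :\: F'))) /=; last first.
      by move=> x; rewrite /= in_setD andbC.
    apply: leq_sum => x; rewrite in_setD => /andP[xF' xF].
    by move: xF'; rewrite in_set xF /= -ltnNge.
  have := cardsID F' F; rewrite (setIidPr F'F) => <-.
  move: h_sum; have := cardsID F' F; rewrite (setIidPr F'F) => <-.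
  move: (#|F'|) (#|F :\: F'|) (#|S|) (\sum_(x in F) h x)%N Spos => a b s w.
  nia.
have p34 : 0 < 3 / 4 :> R by lra.
(* Since [4 * h x <= #|S|] on [F'], each member contributes at least [(3/4) ^+ #|S|] to the
   generating function at [l = (3/4) ^+ 4]. *)
have key : (#|F'|)%:R * (3/4) ^+ #|S| <= 2 ^+ #|C| * (337/512) ^+ #|S| :> R.
  have -> : (337/512 : R) = (1 + (3/4) ^+ 4) / 2 by field.
  rewrite -(sum_subset_prod t _ SC).
  rewrite -sumr_const mulr_suml.
  rewrite [leRHS](bigID (mem F')) /=.
  rewrite [X in _ <= X + _](eq_bigl (mem F')) /=; last first.
    move=> x; apply/idP/idP => [/andP[]//|xF']; apply/andP; split => //.
    by have := subsetP F'F x xF'; rewrite inE => /andP[].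
  have prod_ge0 (x : {set I}) :
      0 <= \prod_(i in S) (if (i \in x) == t i then (3 / 4) ^+ 4 else 1) :> R.
    by apply: prodr_ge0 => i _; case: ifP => _; rewrite ?exprn_ge0 //; lra.
  apply: (le_trans (y := \sum_(x in F')
     \prod_(i in S) (if (i \in x) == t i then (3 / 4) ^+ 4 else 1))); last first.
    by rewrite lerDl sumr_ge0.
  apply: ler_sum => x; rewrite inE => /andP[_ hx].
  rewrite mul1r -big_mkcondr /= prodr_const.
  rewrite -exprM; apply: ler_wiXn2l; [lra|lra|].
  apply: leq_trans hx; rewrite leq_mul2l /=; apply: eq_leq; apply: eq_card => i.
  by rewrite [RHS]in_set.
have {}half : (#|F|)%:R <= 2 * (#|F'|)%:R :> R by rewrite -natrM ler_nat.
rewrite aE; apply: (le_trans half); rewrite -mulrA ler_pM2l //.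
have -> : kappa = (337/512) / (3/4) by rewrite /kappa; field.
rewrite (expr_div_n (337 / 512)) mulrA ler_pdivlMr; first exact: key.
exact: exprn_gt0 p34.
Qed.

(** Either at most a 64th of [C] is bad, which gives the first term, or more than [j] coordinates
    are bad and [sec_le_bad] makes the section itself small. *)
Lemma sum_bad_le A C (j : nat) : (64 * j <= #|C|)%N ->
  \sum_(i in C | bad A C i) (sec A C)%:R
  <= \sum_(i in C) ((sec A C)%:R / 64 + 2 * 2 ^+ #|C| * kappa ^+ j) :> R.
Proof.
move=> jC; set S := [set i in C | bad A C i].
rewrite (eq_bigl (mem S)); last by move=> i; rewrite /= inE.
rewrite !sumr_const -[leLHS]mulr_natr -[leRHS]mulr_natr.
have k0 := kappa_gt0; have k1 := kappa_lt1.
have e0 : 0 <= 2 * 2 ^+ #|C| * kappa ^+ j.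
  by rewrite !mulr_ge0 // exprn_ge0 // ltW.
have a0 : 0 <= (sec A C)%:R :> R by [].
case: (leqP (64 * #|S|) #|C|) => [le|lt].
  have : (64 : R) * (#|S|)%:R <= (#|C|)%:R by rewrite -natrM ler_nat.
  have c0 : 0 <= (#|C|)%:R :> R by [].
  move=> ?; nra.
have Sj : (j <= #|S|)%N by lia.
have SC : (#|S|)%:R <= (#|C|)%:R :> R.
  by rewrite ler_nat subset_leq_card //; apply/subsetP => i; rewrite inE => /andP[].
have le : (sec A C)%:R <= 2 * 2 ^+ #|C| * kappa ^+ j.
  apply: (le_trans (sec_le_bad A C)); rewrite ler_wpM2l //.
    by rewrite mulr_ge0 // exprn_ge0.
  by rewrite ler_wiXn2l // ltW.
have s0 : 0 <= (#|S|)%:R :> R by [].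
nra.
Qed.

(* A pair (i, T) with i outside T encodes Razborov's random partition into {i},
   T and the rest, where x lives off T, y lives on i |: T, and i is the only
   possible common element. *)
Definition splits m (p : I * {set I}) : bool := (p.1 \notin p.2) && (#|p.2| == m).

Definition disj_count A B m : R :=
  \sum_(p | splits m p) (sec A (~: p.2 :\ p.1))%:R * (sec B p.2)%:R.
Definition meet_count A B m : R :=
  \sum_(p | splits m p) (secin A (~: p.2) p.1)%:R * (secin B (p.1 |: p.2) p.1)%:R.

Lemma sum_splits m (F : I -> {set I} -> R) :
  \sum_(p | splits m p) F p.1 p.2
  = \sum_(T : {set I} | #|T| == m) \sum_(i in ~: T) F i T.
Proof.
rewrite (exchange_big_dep predT) //= pair_big_dep /=.
by apply: eq_bigl => -[i T]; rewrite /splits /= in_setC andbC.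
Qed.

(** For each [T], the full section [sec A (~: T)] does not depend on [i], so [sum_bad_le] applies to
    it; on good splits removing [i] loses at most a factor 8, which leads back from full sections to
    [disj_count]. *)
Lemma disj_count_bad A B m j : (64 * j <= #|I| - m)%N ->
  \sum_(p | splits m p && bad A (~: p.2) p.1)
     (sec A (~: p.2 :\ p.1))%:R * (sec B p.2)%:R
  <= disj_count A B m / 4
     + \sum_(p | splits m p) 4 * 2 ^+ #|I| * kappa ^+ j :> R.
Proof.
move=> hj.
have k0 : 0 <= kappa ^+ j by rewrite exprn_ge0 // ltW // kappa_gt0.
pose Q : R := \sum_(p | splits m p) (sec A (~: p.2))%:R * (sec B p.2)%:R.
pose P : R := \sum_(p | splits m p && bad A (~: p.2) p.1)
  (sec A (~: p.2))%:R * (sec B p.2)%:R.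
set err := \sum_(p | splits m p) _.
have PQ : P <= Q / 64 + err / 2.
  rewrite /P /Q /err !mulr_suml -big_split /= big_mkcondr /=.
  rewrite (sum_splits m (fun i T => if bad A (~: T) i
     then (sec A (~: T))%:R * (sec B T)%:R else 0)).
  rewrite (sum_splits m (fun i T => (sec A (~: T))%:R * (sec B T)%:R / 64
     + 4 * 2 ^+ #|I| * kappa ^+ j / 2)).
  apply: ler_sum => T /eqP Tm.
  rewrite -big_mkcondr /= -mulr_suml.
  have CT : (#|~: T| = #|I| - m)%N by rewrite -Tm -(cardsC T) addKn.
  have le : (64 * j <= #|~: T|)%N by rewrite CT.
  apply: (le_trans (y := (\sum_(i in ~: T) ((sec A (~: T))%:R / 64
      + 2 * 2 ^+ #|~: T| * kappa ^+ j)) * (sec B T)%:R)).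
    by rewrite ler_wpM2r // sum_bad_le.
  rewrite mulr_suml; apply: ler_sum => i _.
  have bT : (sec B T)%:R <= 2 ^+ #|T| :> R by rewrite -natrX ler_nat sec_le.
  rewrite mulrDl lerD //; first by rewrite mulrAC.
  apply: (le_trans (y := 2 * 2 ^+ #|~: T| * kappa ^+ j * 2 ^+ #|T|)).
    by rewrite ler_wpM2l // !mulr_ge0 // exprn_ge0.
  rewrite -(cardsC T) exprD le_eqVlt; apply/orP; left; apply/eqP; by field.
have QP : Q - P <= 8 * disj_count A B m.
  rewrite /Q /P /disj_count mulr_sumr (bigID (fun p => bad A (~: p.2) p.1)) /=.
  rewrite addrC addrK [leRHS](bigID (fun p => bad A (~: p.2) p.1)) /=.
  rewrite -[leLHS]add0r lerD //; first by apply: sumr_ge0 => p _; rewrite !mulr_ge0.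
  apply: ler_sum => p /andP[_]; rewrite /bad negb_or -!leqNgt => /andP[h _].
  by rewrite mulrA ler_wpM2r // -natrM ler_nat.
have LP : \sum_(p | splits m p && bad A (~: p.2) p.1)
     (sec A (~: p.2 :\ p.1))%:R * (sec B p.2)%:R <= P.
  apply: ler_sum => p _; rewrite ler_wpM2r // ler_nat (sec_split A (~: p.2) p.1).
  exact: leq_addr.
have D0 : 0 <= disj_count A B m by apply: sumr_ge0 => p _; rewrite mulr_ge0.
have E0 : 0 <= err.
  by apply: sumr_ge0 => p _; rewrite !mulr_ge0 // exprn_ge0.
(* With [D] for [disj_count A B m], [P <= (P + 8 * D) / 64 + err / 2] gives [P <= D / 4 + err]. *)
apply: (le_trans LP); move: PQ QP D0 E0; clear; move: P Q err (disj_count A B m).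
by move=> *; lra.
Qed.

(** Exchanges the players: Alice's region without [i] takes the place of Bob's region [T]. It is an
    involution on splits, so bounds for Alice transfer to Bob. *)
Definition flip_split (p : I * {set I}) : I * {set I} := (p.1, ~: p.2 :\ p.1).

Lemma setC_flip (i : I) T : ~: (~: T :\ i) = i |: T.
Proof. by apply/setP => k; rewrite !inE negb_and !negbK. Qed.

Lemma flip_splitK m p : splits m p -> flip_split (flip_split p) = p.
Proof.
case: p => i T /andP[/= iT _]; rewrite /flip_split /= setC_flip.
congr (_, _); apply/setP => k; rewrite !inE.
by case: eqP => //= ->; rewrite (negbTE iT).
Qed.

Lemma splits_flip m p : (m < #|I|)%N -> splits m p -> splits (#|I| - m).-1 (flip_split p).
Proof.
case: p => i T mI /andP[/= iT /eqP Tm]; rewrite /splits /= !inE eqxx /=.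
have := cardsD1 i (~: T); rewrite in_setC iT => h.
by have := cardsC T; rewrite h Tm add1n addnS => <-; rewrite subSn ?leq_addr // addKn.
Qed.

Lemma sum_splits_flip m (F : I * {set I} -> R) : (m < #|I|)%N ->
  \sum_(p | splits (#|I| - m).-1 p) F p = \sum_(p | splits m p) F (flip_split p).
Proof.
move=> mI; rewrite (reindex_onto flip_split flip_split) /=; last first.
  by move=> p; apply: flip_splitK.
apply: eq_bigl => p; apply/andP/idP => [[sp /eqP pE]|sp].
  have lt : ((#|I| - m).-1 < #|I|)%N by lia.
  rewrite -pE; have := splits_flip lt sp.
  by have -> : (#|I| - (#|I| - m).-1).-1 = m by lia.
by split; [apply: splits_flip|apply/eqP; apply: flip_splitK sp].
Qed.

Lemma disj_count_flip A B m : (m < #|I|)%N ->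
  disj_count B A (#|I| - m).-1 = disj_count A B m.
Proof.
move=> mI; rewrite /disj_count sum_splits_flip //; apply: eq_bigr => p sp /=.
rewrite mulrC; congr (_ * (sec B _)%:R).
by have := congr1 snd (flip_splitK sp).
Qed.

(* For given T the number sec B T does not depend on i, while by sec_le_bad a
   large section is balanced at all but few of the i outside T; so the bad
   splits carry at most half of disj_count. *)
Lemma disj_le_meet A B m j : (m < #|I|)%N ->
    (64 * j <= #|I| - m)%N -> (64 * j <= m.+1)%N ->
  disj_count A B m <= 128 * meet_count A B m
     + \sum_(p | splits m p) 16 * 2 ^+ #|I| * kappa ^+ j.
Proof.
move=> mI j1 j2.
have hA := disj_count_bad A B j1.
(* Bob's bad splits are Alice's after flipping; the flipped set leaves [m.+1] elements outside it,
   whence the second condition on [j]. *)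
have := @disj_count_bad B A (#|I| - m).-1 j.
have -> : (#|I| - (#|I| - m).-1 = m.+1)%N by lia.
move=> /(_ j2); rewrite disj_count_flip // big_mkcondr /= !sum_splits_flip //=.
rewrite -big_mkcondr /= => hB.
set err := \sum_(p | splits m p) _ in hA.
have -> : \sum_(p | splits m p) 16 * 2 ^+ #|I| * kappa ^+ j = 4 * err.
  by rewrite /err mulr_sumr; apply: eq_bigr => p _; rewrite !mulrA; congr (_ * _ * _); ring.
(* A bad split is charged to the side where it is bad; otherwise each side loses a factor 8 on
   passing to the inputs that contain [i]. *)
have pt (p : I * {set I}) : splits m p ->
   (sec A (~: p.2 :\ p.1))%:R * (sec B p.2)%:R <=
   64 * ((secin A (~: p.2) p.1)%:R * (secin B (p.1 |: p.2) p.1)%:R)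
   + (if bad A (~: p.2) p.1 then (sec A (~: p.2 :\ p.1))%:R * (sec B p.2)%:R else 0)
   + (if bad B (~: (~: p.2 :\ p.1)) p.1 then
        (sec B (~: (~: p.2 :\ p.1) :\ p.1))%:R * (sec A (~: p.2 :\ p.1))%:R else 0) :> R.
  move=> sp; have fl := congr1 snd (flip_splitK sp); rewrite /= in fl.
  rewrite fl setC_flip; rewrite setC_flip in fl.
  case: ifP => [_|/negbT badA].
    rewrite addrAC lerDr; apply: addr_ge0; first by rewrite !mulr_ge0.
    by case: ifP => // _; rewrite mulr_ge0.
  case: ifP => [_|/negbT badB].
    by rewrite addr0 [X in _ <= _ + X]mulrC lerDr !mulr_ge0.
  rewrite !addr0 -!natrM ler_nat.
  move: badA badB; rewrite /bad !negb_or -!leqNgt => /andP[_ a8] /andP[_ b8].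
  have := sec_split A (~: p.2) p.1; have := sec_split B (p.1 |: p.2) p.1; rewrite fl.
  move: a8 b8; clear; nia.
have {pt} := ler_sum (index_enum _) pt.
rewrite !big_split /= -mulr_sumr -!big_mkcondr /= -/(disj_count A B m) -/(meet_count A B m).
move: hA hB; rewrite -/err => hA hB h.
have {h hA hB} := le_trans h (lerD (lerD (lexx _) hA) hB).
(* With [D] and [M] for the two counts, [D <= 64 * M + D / 2 + 2 * err]. *)
by move: (disj_count A B m) (meet_count A B m) (err); clear => *; lra.
Qed.

(** * Razborov's two distributions *)

Definition norm_const m : R := \sum_(p | splits m p) 2 ^+ #|I|.-1.

Definition disj_weight m x y : R := (norm_const m)^-1 *
  \sum_(p | splits m p) ((x \subset ~: p.2 :\ p.1) && (y \subset p.2))%:R.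

Definition meet_weight m x y : R := (norm_const m)^-1 *
  \sum_(p | splits m p) ((x \subset ~: p.2) && (p.1 \in x) &&
                         ((y \subset p.1 |: p.2) && (p.1 \in y)))%:R.

Lemma norm_const_gt0 m : (m < #|I|)%N -> 0 < norm_const m.
Proof.
move=> mI; rewrite /norm_const sumr_const pmulrn_lgt0 ?exprn_gt0 //.
have /card_gt0P[i _] : (0 < #|I|)%N by lia.
have : (m <= #|[set~ i]|)%N by rewrite cardsC1; lia.
rewrite -bin_gt0 -cards_draws => /card_gt0P[T]; rewrite inE => /andP[iT Tm].
apply/card_gt0P; exists (i, T); rewrite unfold_in /splits /= Tm andbT.
by apply/negP => /(subsetP iT); rewrite !inE eqxx.
Qed.

Lemma weight_disjoint m x y : disj_weight m x y != 0 -> [disjoint x & y].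
Proof.
apply: contraR => xy; rewrite /disj_weight big1 ?mulr0 // => p _.
apply/eqP; rewrite pnatr_eq0 eqb0; apply: contra xy => /andP[xp yp].
apply: disjointWr yp _; apply: disjointWl xp _.
rewrite -setI_eq0; apply/eqP/setP => k; rewrite !inE.
by case: (k \in p.2); rewrite ?andbF.
Qed.

Lemma weight_meet m x y : meet_weight m x y != 0 -> ~~ [disjoint x & y].
Proof.
apply: contraL => xy; rewrite negbK /meet_weight big1 ?mulr0 // => p _.
apply/eqP; rewrite pnatr_eq0 eqb0; apply: contraL xy => /andP[/andP[_ ix] /andP[_ iy]].
by apply/pred0Pn; exists p.1; rewrite /= ix.
Qed.

(** For a fixed split the two players' sets are chosen independently, so the mass of a rectangle is
    a product of two section counts. *)
Lemma sum_rect (c : R) m (P Q : I * {set I} -> pred {set I}) (A B : pred {set I}) :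
  \sum_x \sum_y (c * \sum_(p | splits m p) (P p x && Q p y)%:R) * (A x && B y)%:R
  = c * \sum_(p | splits m p) (#|[set x in [set x | A x] | P p x]|)%:R
                             * (#|[set y in [set y | B y] | Q p y]|)%:R.
Proof.
transitivity (\sum_x \sum_y \sum_(p | splits m p)
    c * ((A x && P p x)%:R * (B y && Q p y)%:R)).
  apply: eq_bigr => x _; apply: eq_bigr => y _.
  rewrite -mulrA mulr_suml mulr_sumr; apply: eq_bigr => p _.
  by rewrite -!natrM !mulnb; congr (_ * (nat_of_bool _)%:R);
    case: (A x); case: (B y); case: (P p x); case: (Q p y).
under eq_bigr do rewrite exchange_big /=.
rewrite exchange_big mulr_sumr; apply: eq_bigr => p _ /=.
have cardE (D : pred {set I}) (G : pred {set I}) :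
   (#|[set x in [set x | D x] | G x]|)%:R = \sum_x (D x && G x)%:R :> R.
  rewrite -sum1_card natr_sum big_mkcond; apply: eq_bigr => x _.
  by rewrite !inE; case: (_ && _).
rewrite !cardE mulr_suml mulr_sumr; apply: eq_bigr => x _.
by rewrite mulr_sumr mulr_sumr.
Qed.

Lemma sum_disj_weight m (A B : pred {set I}) :
  \sum_x \sum_y disj_weight m x y * (A x && B y)%:R
  = (norm_const m)^-1 * disj_count [set x | A x] [set y | B y] m.
Proof.
exact: (sum_rect _ m (fun p x => x \subset ~: p.2 :\ p.1) (fun p y => y \subset p.2)).
Qed.

Lemma sum_meet_weight m (A B : pred {set I}) :
  \sum_x \sum_y meet_weight m x y * (A x && B y)%:R
  = (norm_const m)^-1 * meet_count [set x | A x] [set y | B y] m.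
Proof.
exact: (sum_rect _ m (fun p x => (x \subset ~: p.2) && (p.1 \in x))
                     (fun p y => (y \subset p.1 |: p.2) && (p.1 \in y))).
Qed.

End Sections.

(** * Corruption for the normalised distributions *)

Section Corruption.
Variables (R : realFieldType) (I : finType) (m : nat).
Hypothesis mI : (m < #|I|)%N.

Definition hard_weight (b : bool) : {set I} -> {set I} -> R :=
  if b then @disj_weight R I m else @meet_weight R I m.

Lemma card_splits (p : I * {set I}) : splits m p ->
  [/\ #|~: p.2 :\ p.1| = (#|I| - m).-1, #|p.2| = m & p.1 \in ~: p.2].
Proof.
move=> sp; have /andP[_ /eqP] := splits_flip mI sp.
by case/andP: (sp) => ? /eqP; rewrite in_setC.
Qed.

Lemma hard_weight_prob b : prob_weight (hard_weight b).
Proof.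
have K0 := @norm_const_gt0 R I m mI.
have sumT (w : {set I} -> {set I} -> R) :
    \sum_x \sum_y w x y = \sum_x \sum_y w x y * (predT x && predT y)%:R.
  by apply: eq_bigr => x _; apply: eq_bigr => y _; rewrite mulr1.
have setTE : [set x | @predT {set I} x] = setT by apply/setP => x; rewrite !inE.
(* In either distribution a split leaves [#|I|.-1] memberships free, so one normalisation serves
   both. *)
have pow2 : 2 ^+ #|I|.-1 = (2 ^ (#|I| - m).-1)%:R * (2 ^ m)%:R :> R.
  by rewrite -natrM -expnD natrX; congr (_ ^+ _); move: mI; lia.
rewrite /hard_weight; case: b; split.
- by move=> x y; apply: mulr_ge0; rewrite ?invr_ge0 ?(ltW K0) // sumr_ge0.
- rewrite sumT sum_disj_weight setTE /disj_count.
  rewrite (eq_bigr (fun=> 2 ^+ #|I|.-1)); first by rewrite mulVf // gt_eqF.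
  by move=> p /card_splits[c1 c2 _]; rewrite !sec_setT c1 c2 pow2.
- by move=> x y; apply: mulr_ge0; rewrite ?invr_ge0 ?(ltW K0) // sumr_ge0.
rewrite sumT sum_meet_weight setTE /meet_count.
rewrite (eq_bigr (fun=> 2 ^+ #|I|.-1)); first by rewrite mulVf // gt_eqF.
move=> p /card_splits[c1 c2 ip]; rewrite !secin_setT ?setU11 // c1 setU1K ?c2 ?pow2 //.
by rewrite -in_setC.
Qed.

Lemma hard_weight_supp b x y : hard_weight b x y != 0 -> [disjoint x & y] = b.
Proof. by case: b => [/weight_disjoint|/weight_meet/negbTE]. Qed.

Lemma hard_weight_corruption j (A B : pred {set I}) :
    (64 * j <= #|I| - m)%N -> (64 * j <= m.+1)%N ->
  1 / 128 * (\sum_x \sum_y hard_weight true x y * (A x && B y)%:R)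
  <= \sum_x \sum_y hard_weight false x y * (A x && B y)%:R + kappa R ^+ j.
Proof.
move=> j1 j2; rewrite sum_disj_weight sum_meet_weight.
have := disj_le_meet R [set x | A x] [set y | B y] mI j1 j2.
have K0 := @norm_const_gt0 R I m mI.
(* After division by 128 the error [32 * kappa R ^+ j] is below [kappa R ^+ j]. *)
have -> : \sum_(p : I * {set I} | splits m p) 16 * 2 ^+ #|I| * kappa R ^+ j
   = norm_const R I m * (32 * kappa R ^+ j).
  rewrite /norm_const mulr_suml; apply: eq_bigr => p _.
  have -> : #|I| = #|I|.-1.+1 by move: mI; lia.
  by rewrite exprS /=; ring.
have k0 : 0 <= kappa R ^+ j by rewrite exprn_ge0 // ltW // kappa_gt0.
move: (disj_count _ _ _ _) (meet_count _ _ _ _) (norm_const _ _ _) K0 (kappa R ^+ j) k0.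
clear => d e K K0 v v0 h.
rewrite mulrCA -(ler_pM2l K0) mulrDr !mulrA divff ?gt_eqF // !mul1r.
have : 0 <= K * v by rewrite mulr_ge0 // ltW.
by move: h; rewrite mulrCA; move: (K * v); clear => *; lra.
Qed.

End Corruption.

(** * Direct product *)

(** Multiply the AM-GM bound [t <= (a + b) / 2] by [e] and use [b * e <= b]. *)
Lemma AGM_mul_le (R : realFieldType) (a b t e : R) :
  0 < a -> 0 < b -> 0 < t -> a * b = t ^+ 2 -> 0 <= e -> e <= 1 ->
  t * e <= (a * e + b) / 2.
Proof.
move=> a0 b0 t0 ab e0 e1.
have tab : t <= (a + b) / 2.
  have : t ^+ 2 <= ((a + b) / 2) ^+ 2.
    rewrite -ab -subr_ge0.
    have -> : ((a + b) / 2) ^+ 2 - a * b = ((a - b) / 2) ^+ 2 by field.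
    exact: sqr_ge0.
  by rewrite ler_pXn2r // nnegrE ltW // divr_gt0 // addr_gt0.
have : t * e <= (a + b) / 2 * e by rewrite ler_wpM2r.
have : b * e <= b by rewrite ler_piMr // ltW.
lra.
Qed.

(** * Expectations under products of weights *)

Section Expectation.
Variables (R : realFieldType) (X : finType).
Implicit Types (w : X -> X -> R) (ws : seq (X -> X -> R)).
Implicit Types (F G : seq X -> seq X -> R).

(** One weight per list entry lets the instances have different distributions and permits induction
    on their number. *)
Fixpoint expect ws F : R :=
  if ws is w :: ws' then
    \sum_x \sum_y w x y * expect ws' (fun xs ys => F (x :: xs) (y :: ys))
  else F [::] [::].

Lemma eq_expect ws F G : (forall xs ys, F xs ys = G xs ys) ->
  expect ws F = expect ws G.
Proof.
elim: ws F G => [|w ws IH] F G FG //=.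
by apply: eq_bigr => x _; apply: eq_bigr => y _; congr (_ * _); apply: IH.
Qed.

Lemma le_expect ws F G : (forall w, List.In w ws -> nonneg_weight w) ->
  (forall xs ys, F xs ys <= G xs ys) -> expect ws F <= expect ws G.
Proof.
elim: ws F G => [|w ws IH] F G w0 FG //=.
apply: ler_sum => x _; apply: ler_sum => y _; apply: ler_wpM2l.
  by apply: w0; left.
by apply: IH => // w' w'in; apply: w0; right.
Qed.

Lemma expectZ ws c F : expect ws (fun xs ys => c * F xs ys) = c * expect ws F.
Proof.
elim: ws F => [|w ws IH] F //=.
rewrite mulr_sumr; apply: eq_bigr => x _; rewrite mulr_sumr.
by apply: eq_bigr => y _; rewrite IH mulrCA.
Qed.

Lemma expectD ws F G :
  expect ws (fun xs ys => F xs ys + G xs ys) = expect ws F + expect ws G.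
Proof.
elim: ws F G => [|w ws IH] F G //=.
rewrite -big_split; apply: eq_bigr => x _ /=; rewrite -big_split.
by apply: eq_bigr => y _ /=; rewrite IH mulrDr.
Qed.

Lemma expect0 ws : expect ws (fun _ _ => 0) = 0.
Proof.
elim: ws => [|w ws IH] //=.
by apply: big1 => x _; apply: big1 => y _; rewrite IH mulr0.
Qed.

Lemma expect_sum ws (J : finType) (F : J -> seq X -> seq X -> R) :
  expect ws (fun xs ys => \sum_j F j xs ys) = \sum_j expect ws (F j).
Proof.
elim: (index_enum J) => [|j s IH].
  by rewrite big_nil -[RHS](expect0 ws); apply: eq_expect => *; rewrite big_nil.
rewrite big_cons -IH -expectD; apply: eq_expect => *; exact: big_cons.
Qed.

Lemma expect_cst ws c : (forall w, List.In w ws -> prob_weight w) ->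
  expect ws (fun _ _ => c) = c.
Proof.
elim: ws => [|w ws IH] //= pw.
rewrite IH; last by move=> w' ?; apply: pw; right.
have [_ w1] := pw w (or_introl erefl).
by rewrite -[RHS]mul1r -w1 mulr_suml; apply: eq_bigr => x _; rewrite mulr_suml.
Qed.

Lemma expect_exchange ws w F :
  \sum_x \sum_y w x y * expect ws (fun xs ys => F (x :: xs) (y :: ys))
  = expect ws (fun xs ys => \sum_x \sum_y w x y * F (x :: xs) (y :: ys)).
Proof.
rewrite expect_sum; apply: eq_bigr => x _; rewrite expect_sum.
by apply: eq_bigr => y _; rewrite expectZ.
Qed.

End Expectation.

(** * Tensorising the corruption bound *)

Section DirectProduct.
Variables (R : realFieldType) (X : finType) (u : bool -> X -> X -> R).
Variables (f : X -> X -> bool) (alpha delta : R).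
Hypothesis u_prob : forall b, prob_weight (u b).
Hypothesis u_supp : forall b x y, u b x y != 0 -> f x y = b.
Hypotheses (alpha_ge0 : 0 <= alpha) (alpha_le1 : alpha <= 1) (delta_ge0 : 0 <= delta).
Hypothesis corruption : forall A B : pred X,
  alpha * (\sum_x \sum_y u true x y * (A x && B y)%:R)
  <= \sum_x \sum_y u false x y * (A x && B y)%:R + delta.

Local Notation E z := (@expect R X (map u z)).

Lemma map_u_prob z w : List.In w (map u z) -> prob_weight w.
Proof. by elim: z => //= b z IH [<-|/IH]. Qed.

Lemma map_u_nonneg z w : List.In w (map u z) -> nonneg_weight w.
Proof. by case/map_u_prob. Qed.

Definition mix x y : R := (u true x y + u false x y) / 2.

Lemma mix_prob : prob_weight mix.
Proof.
have [t0 t1] := u_prob true; have [f0 f1] := u_prob false; split.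
  by move=> x y; rewrite /mix; have := t0 x y; have := f0 x y; lra.
rewrite /mix.
under eq_bigr do rewrite -mulr_suml big_split.
by rewrite -mulr_suml big_split /= t1 f1; field.
Qed.

Lemma nseq_mix_prob k w : List.In w (nseq k mix) -> prob_weight w.
Proof. by elim: k => //= k IH [<-|/IH //]; exact: mix_prob. Qed.

Lemma nseq_mix_nonneg k w : List.In w (nseq k mix) -> nonneg_weight w.
Proof. by case/nseq_mix_prob. Qed.

Local Notation N k := (@expect R X (nseq k mix)).

(** By corruption, the mixture mass of a rectangle is at least [(1 + alpha) / 2] times its [u true]
    mass, minus [delta / 2], and at least half its [u false] mass; [gain] multiplies these
    factors. *)
Definition gain z : R := \prod_(b <- z) (if b then (1 + alpha) / 2 else 1 / 2).

Lemma gain_ge0 z : 0 <= gain z.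
Proof. by apply: prodr_ge0 => b _; have := alpha_ge0; case: b => /=; lra. Qed.

Lemma gain_le1 z : gain z <= 1.
Proof.
move: (alpha_ge0) (alpha_le1) => a0 a1; rewrite /gain; elim: z => [|b z IH]; rewrite ?big_nil // big_cons.
have := gain_ge0 z; rewrite /gain => ?; case: b => /=; nra.
Qed.

(** Tuples whose answer vector differs from [z] have weight 0. *)
Lemma expect_support x0 z F G :
  (forall xs ys, (forall i, (i < size z)%N ->
      f (nth x0 xs i) (nth x0 ys i) = nth false z i) -> F xs ys = G xs ys) ->
  E z F = E z G.
Proof.
elim: z F G => [|b z IH] F G FG /=; first exact: FG.
apply: eq_bigr => x _; apply: eq_bigr => y _.
have [->|/u_supp fxy] := eqVneq (u b x y) 0; first by rewrite !mul0r.
by congr (_ * _); apply: IH => xs ys xsys; apply: FG => -[|i] //=; apply: xsys.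
Qed.

(** Hybrid argument: the slice of a rectangle at a fixed first pair, or at fixed remaining pairs, is
    again a rectangle. The mixture replaces one instance's distribution at a time, each time at a
    cost of at most [delta] since [gain z <= 1]. *)
Lemma corruption_tensor z (A B : pred (seq X)) :
  gain z * E z (fun xs ys => (A xs && B ys)%:R)
  <= N (size z) (fun xs ys => (A xs && B ys)%:R) + (size z)%:R * delta.
Proof.
elim: z A B => [|b z IH] A B.
  by rewrite /gain big_nil mul1r mul0r addr0.
have exchange w : \sum_x \sum_y w x y * E z (fun xs ys => (A (x :: xs) && B (y :: ys))%:R)
    = E z (fun xs ys => \sum_x \sum_y w x y * (A (x :: xs) && B (y :: ys))%:R).
  exact: (expect_exchange _ _ (fun xs ys => (A xs && B ys)%:R)).
rewrite /= exchange.
have step x y : mix x y * (gain z * E z (fun xs ys => (A (x :: xs) && B (y :: ys))%:R)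
                           - (size z)%:R * delta)
   <= mix x y * N (size z) (fun xs ys => (A (x :: xs) && B (y :: ys))%:R).
  apply: ler_wpM2l; first by case: mix_prob.
  by rewrite lerBlDr; apply: IH.
have {step} : gain z * E z (fun xs ys => \sum_x \sum_y mix x y * (A (x :: xs) && B (y :: ys))%:R)
   - (size z)%:R * delta <=
   \sum_x \sum_y mix x y * N (size z) (fun xs ys => (A (x :: xs) && B (y :: ys))%:R).
  apply: le_trans (ler_sum _ (fun x _ => ler_sum _ (fun y _ => step x y))).
  under [leRHS]eq_bigr do under eq_bigr do rewrite mulrBr.
  under [leRHS]eq_bigr do rewrite sumrB.
  rewrite sumrB lerD //.
    rewrite -exchange.
    rewrite mulr_sumr; apply: ler_sum => x _; rewrite mulr_sumr.
    by apply: ler_sum => y _; rewrite mulrCA.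
  rewrite lerN2 -[leRHS]mul1r -(proj2 mix_prob) mulr_suml.
  by apply: ler_sum => x _; rewrite mulr_suml.
set M := \sum_x _.
have : (if b then 1 + alpha else 1) / 2 * 
   E z (fun xs ys => \sum_x \sum_y u b x y * (A (x :: xs) && B (y :: ys))%:R)
   - delta <= E z (fun xs ys => \sum_x \sum_y mix x y * (A (x :: xs) && B (y :: ys))%:R).
  rewrite lerBlDr -expectZ -[delta in leRHS](expect_cst (ws := map u z)); last first.
    exact: map_u_prob.
  rewrite -expectD; apply: le_expect; first exact: map_u_nonneg.
  move=> xs ys.
  have := corruption (fun x => A (x :: xs)) (fun y => B (y :: ys)).
  have -> : \sum_x \sum_y mix x y * (A (x :: xs) && B (y :: ys))%:R =
     (\sum_x \sum_y u true x y * (A (x :: xs) && B (y :: ys))%:R +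
     \sum_x \sum_y u false x y * (A (x :: xs) && B (y :: ys))%:R) / 2.
    rewrite -big_split mulr_suml; apply: eq_bigr => x _.
    rewrite -big_split mulr_suml; apply: eq_bigr => y _.
    by rewrite /mix /=; ring.
  have s0 c : 0 <= \sum_x \sum_y u c x y * (A (x :: xs) && B (y :: ys))%:R.
    by apply: sumr_ge0 => x _; apply: sumr_ge0 => y _; rewrite mulr_ge0 //; case: (u_prob c).
  have := s0 true; have := s0 false; have := delta_ge0; case: (b); lra.
have g0 := gain_ge0 z; have g1 := gain_le1 z.
rewrite {2}/gain big_cons -/(gain z) -natr1.
have -> : (if b then (1 + alpha) / 2 else 1 / 2) = (if b then 1 + alpha else 1) / 2 by case: b.
set c := _ / 2; set e := E z _; set e' := E z _.
move=> h1 h2.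
have : gain z * (c * e - delta) <= gain z * e' by rewrite ler_wpM2l.
have : gain z * delta <= delta by rewrite ler_piMl.
lra.
Qed.

(** * From rectangles to protocols *)

Section Protocol.
Variables (k : nat) (S T : Type) (phi : seq X -> S) (psi : seq X -> T).
Implicit Types (p : proto S T (koutput k)) (o : {ffun 'I_k -> bool}).

(** The vector [o] is fixed rather than computed from the inputs, so the event is a union of leaf
    rectangles. *)
Definition answers p o (xs ys : seq X) : bool :=
  [forall i, run p (phi xs) (psi ys) i == o i].

(** Each bit splits the rectangle reaching a node in two. A leaf has one output, so a single [o]
    counts there and [corruption_tensor] applies; the error is paid once per leaf, at most
    [2 ^ cost p] times. *)
Lemma protocol_corruption p (A B : pred (seq X)) :
  \sum_(o : {ffun 'I_k -> bool}) gain (codom o) * E (codom o) (fun xs ys => (A xs && B ys && answers p o xs ys)%:R)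
  <= N k (fun xs ys => (A xs && B ys)%:R) + (2 ^ cost p)%:R * (k%:R * delta).
Proof.
have size_o (o : {ffun 'I_k -> bool}) : size (codom o) = k by rewrite size_codom card_ord.
have kd0 : 0 <= k%:R * delta by rewrite mulr_ge0.
have cost2 m n : ((2 ^ m)%:R + (2 ^ n)%:R) * (k%:R * delta)
     <= (2 ^ (maxn m n).+1)%:R * (k%:R * delta).
  rewrite ler_wpM2r // -natrD ler_nat expnS mul2n -addnn leq_add //.
    by rewrite leq_pexp2l // leq_maxl.
  by rewrite leq_pexp2l // leq_maxr.
elim: p A B => [a|g l IHl r IHr|g l IHl r IHr] A B.
- pose o : {ffun 'I_k -> bool} := [ffun i => a i].
  rewrite (bigD1 o) //= big1 ?addr0; last first.
    move=> o' /eqP neq; rewrite -[X in _ * X = _](_ : 0 = _) ?mulr0 //.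
    rewrite -[LHS](expect0 (map u (codom o'))); apply: eq_expect => xs ys.
    suff -> : answers (Leaf a) o' xs ys = false by rewrite andbF.
    by apply/forallP => h; apply: neq; apply/ffunP => i; rewrite ffunE; have /eqP := h i.
  rewrite expn0 mul1r.
  have := corruption_tensor (codom o) A B; rewrite size_o; apply: le_trans.
  rewrite le_eqVlt; apply/orP; left; apply/eqP; congr (_ * _).
  apply: eq_expect => xs ys.
  have -> : answers (Leaf a) o xs ys by apply/forallP => i; rewrite ffunE.
  by rewrite andbT.
- have hr := IHr (fun xs => A xs && g (phi xs)) B.
  have hl := IHl (fun xs => A xs && ~~ g (phi xs)) B.
  have {hl hr} := lerD hr hl; rewrite -big_split /= => h.
  rewrite (eq_bigr (fun o : {ffun 'I_k -> bool} => gain (codom o) * E (codom o)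
     (fun xs ys => (A xs && g (phi xs) && B ys && answers r o xs ys)%:R)
     + gain (codom o) * E (codom o)
     (fun xs ys => (A xs && ~~ g (phi xs) && B ys && answers l o xs ys)%:R))); last first.
    move=> o _; rewrite -mulrDr -expectD; congr (_ * _); apply: eq_expect => xs ys.
    rewrite /answers /=; case: (g _); case: (A xs); case: (B ys); rewrite ?add0r ?addr0 //=.
  apply: (le_trans h).
  rewrite addrACA -mulrDl; apply: lerD; last by rewrite maxnC.
  rewrite -expectD; apply: le_expect; first exact: nseq_mix_nonneg.
  by move=> xs ys; case: (g _); case: (A xs); case: (B ys); rewrite /= ?addr0 ?add0r.
- have hr := IHr A (fun ys => B ys && g (psi ys)).
  have hl := IHl A (fun ys => B ys && ~~ g (psi ys)).
  have {hl hr} := lerD hr hl; rewrite -big_split /= => h.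
  rewrite (eq_bigr (fun o : {ffun 'I_k -> bool} => gain (codom o) * E (codom o)
     (fun xs ys => (A xs && (B ys && g (psi ys)) && answers r o xs ys)%:R)
     + gain (codom o) * E (codom o)
     (fun xs ys => (A xs && (B ys && ~~ g (psi ys)) && answers l o xs ys)%:R))); last first.
    move=> o _; rewrite -mulrDr -expectD; congr (_ * _); apply: eq_expect => xs ys.
    rewrite /answers /=; case: (g _); case: (A xs); case: (B ys); rewrite ?add0r ?addr0 //=.
  apply: (le_trans h).
  rewrite addrACA -mulrDl; apply: lerD; last by rewrite maxnC.
  rewrite -expectD; apply: le_expect; first exact: nseq_mix_nonneg.
  by move=> xs ys; case: (g _); case: (A xs); case: (B ys); rewrite /= ?addr0 ?add0r.
Qed.

Lemma success_le p (r : R) : 0 < r ->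
  (1 + (1 + alpha)^-1) / 2 <= r ^+ 2 ->
  2 ^- k * \sum_(o : {ffun 'I_k -> bool}) E (codom o) (fun xs ys => (answers p o xs ys)%:R)
  <= (1 + (2 ^ cost p)%:R * (k%:R * delta) / 2) * r ^+ k.
Proof.
move=> r0 hr.
have q0 : 0 < 1 + alpha by have := alpha_ge0; lra.
pose q : R := 1 + alpha.
have h := protocol_corruption p (fun=> true) (fun=> true).
rewrite expect_cst in h; last exact: nseq_mix_prob.
rewrite /= in h.
set tau := (2 ^ cost p)%:R * _ in h *.
(* This is [gain] with [1 + alpha] inverted: its product with [gain] is constant, and its sum over
   [o] is at most [r ^+ (2 * k)] by the condition on [r]. *)
pose g' (o : {ffun 'I_k -> bool}) : R := \prod_(i < k) (if o i then q^-1 / 2 else 1 / 2).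
have gainE (o : {ffun 'I_k -> bool}) : gain (codom o) = \prod_(i < k) (if o i then q / 2 else 1 / 2).
  by rewrite /gain big_image.
have sum_g' : \sum_(o : {ffun 'I_k -> bool}) g' o = ((1 + q^-1) / 2) ^+ k.
  rewrite -(bigA_distr_bigA (fun (i : 'I_k) b => if b then q^-1 / 2 else 1 / 2)) /=.
  rewrite (eq_bigr (fun=> (1 + q^-1) / 2)) ?prodr_const ?card_ord //.
  by move=> i _; rewrite big_bool /=; field; rewrite lt0r_neq0.
have gg' o : gain (codom o) * g' o = (2 ^- k) ^+ 2.
  rewrite gainE -big_split /= (eq_bigr (fun=> 4^-1)); last first.
    by move=> i _; case: (o i); field; rewrite ?lt0r_neq0.
  rewrite prodr_const card_ord exprVn -!exprVn -!exprM mulnC exprM; by congr (_ ^+ _); field.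
have g'0 (o : {ffun 'I_k -> bool}) : 0 < g' o.
  apply: prodr_gt0 => i _; have : 0 < q^-1 by rewrite invr_gt0.
  by case: (o i); lra.
have g0 (o : {ffun 'I_k -> bool}) : 0 < gain (codom o).
  by rewrite gainE; apply: prodr_gt0 => i _; case: (o i); rewrite /q; move: q0; lra.
pose e (o : {ffun 'I_k -> bool}) := E (codom o) (fun xs ys => (answers p o xs ys)%:R).
have e0 o : 0 <= e o.
  rewrite -(expect0 (map u (codom o))); apply: le_expect => //.
  exact: map_u_nonneg.
have e1 o : e o <= 1.
  rewrite -[leRHS](expect_cst (ws := map u (codom o))); last exact: map_u_prob.
  apply: le_expect; first exact: map_u_nonneg.
  by move=> xs ys; case: answers.
have rk : 0 < r ^+ k by rewrite exprn_gt0.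
(* AM-GM: 2^-k is the geometric mean of r^k gain o and r^-k g' o. *)
have pt o : 2 ^- k * e o <= (r ^+ k * (gain (codom o) * e o) + r ^- k * g' o) / 2.
  have t0 : 0 < (2 : R) ^- k by rewrite invr_gt0 exprn_gt0.
  pose a := r ^+ k * gain (codom o); pose b := r ^- k * g' o.
  have ab : a * b = (2 ^- k) ^+ 2.
    by rewrite -(gg' o) /a /b; field; rewrite lt0r_neq0.
  have a0 : 0 < a by rewrite mulr_gt0.
  have b0 : 0 < b by rewrite mulr_gt0 // invr_gt0.
  have -> : r ^+ k * (gain (codom o) * e o) = a * e o by rewrite /a mulrA.
  exact: AGM_mul_le.
rewrite mulr_sumr; apply: (le_trans (ler_sum _ (fun o _ => pt o))).
rewrite -mulr_suml big_split /= -!mulr_sumr sum_g'.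
have inv_rk : r ^- k * ((1 + q^-1) / 2) ^+ k <= r ^+ k.
  rewrite mulrC ler_pdivrMr // -exprMn -expr2.
  apply: lerXn2r => //; rewrite nnegrE ltW ?exprn_gt0 //.
  by apply: divr_gt0 => //; rewrite addr_gt0 // invr_gt0.
have {}h : r ^+ k * (\sum_(o : {ffun 'I_k -> bool}) gain (codom o) * e o)
           <= r ^+ k * (1 + tau) by rewrite ler_wpM2l // ltW.
rewrite ler_pdivrMr //; apply: (le_trans (lerD h inv_rk)).
by rewrite le_eqVlt; apply/orP; left; apply/eqP; field.
Qed.

End Protocol.
End DirectProduct.

(** * Choice of constants *)

Lemma kappa_exp (R : realFieldType) : kappa R ^+ 60 <= 1 / 1024.
Proof.
have k6 : kappa R ^+ 6 <= 1 / 2 by rewrite /kappa; lra.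
have -> : (60 = 6 * 10)%N by [].
have -> : 1 / 1024 = (1 / 2) ^+ 10 :> R by field.
rewrite exprM; apply: lerXn2r => //; rewrite nnegrE ?exprn_ge0 // ?ltW ?kappa_gt0 //; lra.
Qed.

(** With [e = c + k], the first factors are at most [2 ^+ e] as [k <= 2 ^ k], and [kappa_exp] gives
    [kappa R ^+ j <= (1 / 1024) ^+ (2 * e)]; the product decays geometrically in [e], which is
    positive. *)
Lemma error_le (R : realFieldType) (c k j : nat) : (0 < k)%N ->
  (120 * (c + k) <= j)%N -> (2 ^ c)%:R * (k%:R * kappa R ^+ j) <= 1 / 1024.
Proof.
move=> k0 hj; have kp := kappa_gt0 R; have kl := kappa_lt1 R.
set e := (c + k)%N in hj.
apply: (le_trans (y := (2 ^+ e) * ((1 / 1024) ^+ (2 * e)))).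
  rewrite mulrA ler_pM //.
  - by rewrite mulr_ge0.
  - by rewrite exprn_ge0 // ltW.
  - by rewrite exprD natrX ler_wpM2l ?exprn_ge0 // -natrX ler_nat ltnW // ltn_expl.
  apply: (le_trans (y := kappa R ^+ (60 * (2 * e)))).
    by apply: ler_wiXn2l; rewrite ?ltW // mulnA.
  have c0 : 0 <= 1 / 1024 :> R by lra.
  by rewrite exprM; apply: (lerXn2r _ _ _ (kappa_exp R)); rewrite nnegrE ?exprn_ge0 ?(ltW kp).
rewrite exprM -exprMn; have -> : e = e.-1.+1 by rewrite /e; lia.
rewrite exprS; set v := 2 * _; have v1 : v <= 1 / 1024 by rewrite /v; lra.
have v0 : 0 <= v by rewrite /v; lra.
apply: le_trans v1; rewrite ler_piMr // exprn_ile1 //; rewrite /v; lra.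
Qed.

(** Since [ln 2 <= 1], [1 - g <= 1 - g * ln 2 <= expR (- (g * ln 2))]. *)
Lemma le_powR_2 (R : realType) (g : R) k : 0 <= g -> g <= 1 ->
  (1 - g) ^+ k <= 2 `^ (- (g * k%:R)).
Proof.
move=> g0 g1; rewrite -mulNr powRrM powR_mulrn ?powR_ge0 //.
apply: lerXn2r; rewrite ?nnegrE ?powR_ge0 ?subr_ge0 //.
rewrite /powR pnatr_eq0 /=; apply: le_trans (expR_ge1Dx _).
rewrite mulNr lerD2l lerN2 ler_piMr //.
have -> : 2 = 1 + 1 :> R by [].
by apply: le_ln1Dx; lra.
Qed.

Lemma DISJ_disjoint n (x y : {set 'I_n}) :
  DISJ (fun i => i \in x) (fun i => i \in y) = [disjoint x & y].
Proof.
apply/forallP/pred0P => h i /=; have := h i; rewrite /=.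
  by move/negbTE.
by move=> ->.
Qed.

(* A (public-coin) randomized protocol = a probability distribution [mu] on a
   finite index set [Omega] of deterministic protocols [P w]. *)
Theorem mainTheorem12 :
  exists eps gamma : Rdefinitions.R, 0 < eps /\ 0 < gamma /\
  forall (n k : nat), k%:R <= eps * n%:R ->
  forall (Omega : finType) (mu : Omega -> Rdefinitions.R)
         (P : Omega -> proto (kinput k n) (kinput k n) (koutput k)),
    (forall w, 0 <= mu w) -> \sum_(w : Omega) mu w = 1 ->
    (forall w, (cost (P w))%:R <= eps * n%:R) ->
    exists x y : kinput k n,
      \sum_(w : Omega | all_correct x y (run (P w) x y)) mu w
        <= 2 `^ (- (gamma * k%:R)).
Proof.
(* The first constant yields [120 * (cost (P w) + k) <= n %/ 128], as [error_le] requires; the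
   second leaves room for [(1 + 1 / 2048) * (515 / 516) < 1 - 1 / 1024]. *)
exists (1 / 240 * (1 / 128)), (1 / 1024); split; first by lra.
split; first by lra.
move=> n k kn Omega mu P mu0 mu1 costP.
have natle (c : nat) : c%:R <= 1 / 240 * (1 / 128) * n%:R :> Rdefinitions.R -> (240 * (128 * c) <= n)%N.
  by move=> h; rewrite -(ler_nat Rdefinitions.R) !natrM; lra.
(* For [k = 0] the claimed bound is 1, the total mass. *)
have [k0|kpos] := posnP k.
  exists (fun _ _ => false), (fun _ _ => false).
  rewrite (_ : k%:R = 0) ?k0 // mulr0 oppr0 powRr0 -mu1 big_mkcond /=; apply: ler_sum => w _.
  by case: ifP.
have {}kn := natle _ kn.
(* Halving the ground set lets [j] satisfy both size conditions of the corruption bound. *)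
pose m := n./2; pose j := (n %/ 128)%N.
have mI : (m < #|'I_n|)%N by rewrite card_ord /m; lia.
have j1 : (64 * j <= #|'I_n| - m)%N by rewrite card_ord /m /j; lia.
have j2 : (64 * j <= m.+1)%N by rewrite /m /j; lia.
pose u := @hard_weight Rdefinitions.R 'I_n m.
pose phi (xs : seq {set 'I_n}) : kinput k n := fun i l => l \in nth set0 xs i.
pose E (o : {ffun 'I_k -> bool}) := expect (map u (codom o)).
(* Chosen so that [2 * r - 1] is [(1 + (1 + 1 / 128)^-1) / 2]; the condition of [success_le] becomes
   [0 <= (r - 1) ^+ 2]. *)
pose r : Rdefinitions.R := 515 / 516.
(* Average success of one deterministic protocol on hard inputs; [1 / 2048] is half of the bound in
   [error_le]. *)
have succ w : 2 ^- k * \sum_(o : {ffun 'I_k -> bool})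
     E o (fun xs ys => (all_correct (phi xs) (phi ys) (run (P w) (phi xs) (phi ys)))%:R)
   <= (1 + 1 / 2048) * r ^+ k.
  have suppE (o : {ffun 'I_k -> bool}) :
      E o (fun xs ys => (all_correct (phi xs) (phi ys) (run (P w) (phi xs) (phi ys)))%:R)
      = E o (fun xs ys => (answers phi phi (P w) o xs ys)%:R).
    apply: (@expect_support _ _ u (fun x y => [disjoint x & y]) _ set0).
      exact: hard_weight_supp.
    move=> xs ys xsys; congr (nat_of_bool _)%:R; apply: eq_forallb => i.
    have := xsys i; rewrite size_codom card_ord ltn_ord => /(_ isT).
    rewrite codomE (nth_map i) ?size_enum_ord ?ltn_ord // nth_ord_enum -DISJ_disjoint => <-.
    by [].
  rewrite (eq_bigr _ (fun o _ => suppE o)).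
  have := @success_le _ _ u (1 / 128) (kappa Rdefinitions.R ^+ j)
     (hard_weight_prob _ mI) _ _ _ _ k _ _ phi phi (P w) r.
  move=> /(_ ltac:(lra) ltac:(lra)).
  have -> : 0 <= kappa Rdefinitions.R ^+ j by rewrite exprn_ge0 // ltW // kappa_gt0.
  move=> /(_ isT (fun A B => hard_weight_corruption _ mI A B j1 j2)).
  have -> : 0 < r by rewrite /r; lra.
  have -> : (1 + (1 + 1 / 128)^-1) / 2 <= r ^+ 2.
    have -> : (1 + (1 + 1 / 128)^-1) / 2 = 2 * r - 1 by rewrite /r; field.
    rewrite -subr_ge0; have -> : r ^+ 2 - (2 * r - 1) = (r - 1) ^+ 2 by ring.
    exact: sqr_ge0.
  move=> /(_ isT isT) h; apply: (le_trans h).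
  rewrite ler_wpM2r ?exprn_ge0 //; first by rewrite /r; lra.
  have cw := natle _ (costP w).
  have := @error_le Rdefinitions.R (cost (P w)) k j kpos.
  have -> : (120 * (cost (P w) + k) <= j)%N by rewrite /j; lia.
  by move=> /(_ isT); lra.
(* Averaging argument: if the success probability exceeded [b] on every input, its average over hard
   inputs would be at least [b]; exchanging this average with the one over [mu] contradicts
   [succ]. *)
apply: contrapT => nex.
set b := 2 `^ _ in nex.
have lt_b x y : b < \sum_(w | all_correct x y (run (P w) x y)) mu w.
  by rewrite ltNge; apply/negP => le; apply: nex; exists x, y.
have b_lt : (1 + 1 / 2048) * r ^+ k < b.
  apply: (lt_le_trans (y := (1 - 1 / 1024) ^+ k)); last by apply: le_powR_2; lra.
  (* As [k] is positive, the constant factor is absorbed into the [k]-th power. *)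
  apply: (le_lt_trans (y := ((1 + 1 / 2048) * r) ^+ k)).
    rewrite [X in _ <= X]exprMn ler_wpM2r ?exprn_ge0 //; first by rewrite /r; lra.
    by rewrite ler_eXnr //; lra.
  by rewrite ltr_pXn2r ?nnegrE // /r; lra.
suff : b <= (1 + 1 / 2048) * r ^+ k by rewrite leNgt b_lt.
have bE (o : {ffun 'I_k -> bool}) : b <= \sum_w mu w *
   E o (fun xs ys => (all_correct (phi xs) (phi ys) (run (P w) (phi xs) (phi ys)))%:R).
  rewrite -[leLHS](expect_cst (ws := map u (codom o))); last first.
    by apply: map_u_prob => c; apply: hard_weight_prob.
  under eq_bigr do rewrite -expectZ.
  rewrite -expect_sum; apply: le_expect.
    by apply: map_u_nonneg => c; apply: hard_weight_prob.
  move=> xs ys; apply: le_trans (ltW (lt_b (phi xs) (phi ys))) _.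
  rewrite big_mkcond; apply: ler_sum => w _.
  by case: ifP => _; rewrite ?mulr1 ?mulr0.
have card_o : \sum_(o : {ffun 'I_k -> bool}) b = 2 ^+ k * b.
  by rewrite sumr_const card_ffun card_bool card_ord -[LHS]mulr_natl natrX.
have -> : b = 2 ^- k * (\sum_(o : {ffun 'I_k -> bool}) b).
  by rewrite card_o mulKf // expf_neq0 // pnatr_eq0.
apply: (le_trans (y := 2 ^- k * \sum_(o : {ffun 'I_k -> bool}) \sum_w mu w *
   E o (fun xs ys => (all_correct (phi xs) (phi ys) (run (P w) (phi xs) (phi ys)))%:R))).
  by rewrite ler_wpM2l ?invr_ge0 ?exprn_ge0 //; apply: ler_sum.
rewrite exchange_big mulr_sumr /= -[leRHS]mul1r -[X in _ <= X * _]mu1 mulr_suml.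
by apply: ler_sum => w _; rewrite -mulr_sumr mulrCA ler_wpM2l.
Qed.
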